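(* Let $D_1$ and $D_2$ be persistence diagrams. If $D_1$ and $D_2$ are orthogonal, then their trivial matching is a perfect matching under the bottleneck distance $W_\infty$ and under the $p$-Wasserstein distance $W_p$ for every real $p\ge1$.
   Context: Fix $\theta_0\in\mathbb{R}$ (the minimum filtration value). A persistence diagram is a finite multiset $D$ (points may have multiplicities, and $D$ may be empty) of points $(b,d)\in\mathbb{R}^2$ with $\theta_0\le b<d<\infty$. The diagonal is $\Delta=\{(\theta,\theta)\mid\theta\ge\theta_0\}$. Distances: for diagrams $D_1,D_2$, let $\Gamma$ be the set of all bijections $\gamma:D_1^\Delta\to D_2^\Delta$, where $D_i^\Delta$ is any multiset obtained from $D_i$ by adding a finite number of points of $\Delta$ (allowing multiplicities); the added points may vary with $\gamma$. With $\|\cdot\|_\infty$ the supremum norm of $\mathbb{R}^2$, the bottleneck distance is $$W_\infty(D_1,D_2)=\inf_{\gamma\in\Gamma}\ \sup_{x\in D_1^\Delta}\|x-\gamma(x)\|_\infty,$$ and for $p\ge1$ the $p$-Wasserstein distance is $$W_p(D_1,D_2)=\inf_{\gamma\in\Gamma}\Big(\sum_{x\in D_1^\Delta}\|x-\gamma(x)\|_\infty^p\Big)^{1/p}.$$ (A supremum over the empty set is $0$.) A bijection $\gamma\in\Gamma$ attaining the infimum for a given one of these distances is called a perfect matching for that distance. The trivial matching of $D_1$ and $D_2$ is the bijection in $\Gamma$ that sends each $(b_1,d_1)\in D_1$ to $\big(\frac{b_1+d_1}{2},\frac{b_1+d_1}{2}\big)$ and sends $\big(\frac{b_2+d_2}{2},\frac{b_2+d_2}{2}\big)$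 to $(b_2,d_2)$ for each $(b_2,d_2)\in D_2$ (with multiplicity); here $D_1^\Delta$ is $D_1$ together with the diagonal points $\big(\frac{b_2+d_2}{2},\frac{b_2+d_2}{2}\big)$, $(b_2,d_2)\in D_2$, and $D_2^\Delta$ is $D_2$ together with the diagonal points $\big(\frac{b_1+d_1}{2},\frac{b_1+d_1}{2}\big)$, $(b_1,d_1)\in D_1$. Persistence landscape: if $D$ has points $(b_1,d_1),\dots,(b_n,d_n)$ (listed with multiplicity), let $g_i:\mathbb{R}\to\mathbb{R}$ be $g_i(t)=t-b_i$ for $t\in[b_i,(b_i+d_i)/2]$, $g_i(t)=d_i-t$ for $t\in[(b_i+d_i)/2,d_i]$, and $g_i(t)=0$ otherwise. For $j\ge1$ let $\lambda_j(t)$ be the $j$-th largest value (counted with multiplicity) among $g_1(t),\dots,g_n(t)$, with $\lambda_j(t)=0$ for $j>n$. The persistence landscape of $D$ is $\varphi(D)=(\lambda_1,\lambda_2,\dots)$; the empty diagram has zero landscape. The inner product of landscapes is $\langle\vec\lambda,\vec\mu\rangle=\sum_{j=1}^\infty\int_{\mathbb{R}}\lambda_j(t)\mu_j(t)\,dt$. Diagrams $D_1$ and $D_2$ are orthogonal if $\langle\varphi(D_1),\varphi(D_2)\rangle=0$. *)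

(* Defs.v *)
From HB Require Import structures.
From mathcomp Require Import all_boot all_order all_algebra.
From mathcomp Require Import finmap multiset.
From mathcomp Require Import all_classical all_reals all_analysis.
Import Order.TTheory GRing.Theory Num.Theory.
Import numFieldNormedType.Exports.

Set Implicit Arguments.
Unset Strict Implicit.
Unset Printing Implicit Defensive.

Local Open Scope classical_set_scope.
Local Open Scope ring_scope.

Section Diagrams.
Context {R : realType} {theta0 : R}.
Implicit Types (x : R * R) (D : {mset (R * R)%type}%mset).

Definition diagonal (theta0 : R) : set (R * R) :=
  [set x | exists2 t, theta0 <= t & x = (t, t)].

Definition midpoint x : R * R := ((x.1 + x.2) / 2, (x.1 + x.2) / 2).

(* A point of multiplicity m in D is dgm_pt i for exactly m indices i. *)
Definition dgm_pt D (i : 'I_(size D)) : R * R := tnth (in_tuple D) i.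

Record diagram (t0 : R) := Diagram {
  dgm_mset :> {mset (R * R)%type}%mset ;
  dgm_valid : forall x, x \in dgm_mset -> t0 <= x.1 < x.2 }.

Lemma midpoint_diagonal (D : diagram theta0) (i : 'I_(size D)) :
  diagonal theta0 (midpoint (dgm_pt i)).
Proof.
have /dgm_valid/andP[h1 h2] : dgm_pt i \in (D : {mset (R * R)%type}%mset).
  by rewrite -topredE /=; exact: mem_tnth.
exists (((dgm_pt i).1 + (dgm_pt i).2) / 2) => //.
by rewrite ler_pdivlMr // mulr_natr mulr2n lerD // (le_trans h1) // ltW.
Qed.

(* An element of Gamma. The multiset D_k^Delta is listed by the index type
   'I_(size D_k) + 'I_n_k: the left summand lists D_k and the right summand
   lists the added diagonal points. *)
Record matching (D1 D2 : diagram theta0) := Matching {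
  nadd1 : nat ;
  nadd2 : nat ;
  add1 : 'I_nadd1 -> R * R ;
  add2 : 'I_nadd2 -> R * R ;
  add1_diagonal : forall i, diagonal theta0 (add1 i) ;
  add2_diagonal : forall i, diagonal theta0 (add2 i) ;
  gamma : 'I_(size D1) + 'I_nadd1 -> 'I_(size D2) + 'I_nadd2 ;
  gamma_bij : bijective gamma }.

Definition ext_pt D n (add : 'I_n -> R * R) (i : 'I_(size D) + 'I_n) : R * R :=
  match i with inl k => dgm_pt k | inr k => add k end.

Section Distances.
Variables D1 D2 : diagram theta0.

(* The norm of R * R is the supremum norm. *)
Definition displacement (g : matching D1 D2)
    (i : 'I_(size D1) + 'I_(nadd1 g)) : R :=
  `| ext_pt (@add1 _ _ g) i - ext_pt (@add2 _ _ g) (gamma i) |.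

(* Displacements are nonnegative, so starting the maximum at 0 only fixes the
   value of the empty supremum. *)
Definition bottleneck_cost (g : matching D1 D2) : R :=
  \big[Num.max/0]_i @displacement g i.

Definition wasserstein_cost (p : R) (g : matching D1 D2) : R :=
  (\sum_i (@displacement g i) `^ p) `^ p^-1.

Definition bottleneck_distance : R := inf (range bottleneck_cost).

Definition wasserstein_distance (p : R) : R := inf (range (wasserstein_cost p)).

Definition bottleneck_perfect (g : matching D1 D2) : Prop :=
  bottleneck_cost g = bottleneck_distance.

Definition wasserstein_perfect (p : R) (g : matching D1 D2) : Prop :=
  wasserstein_cost p g = wasserstein_distance p.

Definition swap_sum (A B : Type) (u : A + B) : B + A :=
  match u with inl a => inr a | inr b => inl b end.

Lemma swap_sum_bij (A B : Type) : bijective (@swap_sum A B).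
Proof. by exists (@swap_sum B A); case. Qed.

(* The k-th point of D1 goes to the k-th added point of D2^Delta, its own
   midpoint; the k-th added point of D1^Delta, which is the midpoint of the
   k-th point of D2, goes to that point. *)
Definition trivial_matching : matching D1 D2 :=
  Matching (@midpoint_diagonal D2) (@midpoint_diagonal D1)
    (swap_sum_bij 'I_(size D1) 'I_(size D2)).

End Distances.

Definition tent x (t : R) : R :=
  if x.1 <= t <= (x.1 + x.2) / 2 then t - x.1
  else if (x.1 + x.2) / 2 <= t <= x.2 then x.2 - t
  else 0.

(* Indexed from 0: landscape D j is lambda_(j+1). *)
Definition landscape D (j : nat) (t : R) : R :=
  nth 0 (sort >=%R [seq tent x t | x <- D]) j.

(* Extended-real valued; landscape functions are nonnegative. *)
Definition landscape_inner (l m : nat -> R -> R) : \bar R :=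
  (\sum_(0 <= j <oo) \int[@lebesgue_measure R]_t (l j t * m j t)%:E)%E.

Definition orthogonal_diagrams (D1 D2 : diagram theta0) : Prop :=
  landscape_inner (landscape D1) (landscape D2) = 0%E.

End Diagrams.

(* Main.v *)
Require Import Defs.
From mathcomp Require Import all_boot all_order all_algebra.
From mathcomp Require Import all_classical all_reals all_analysis.
From mathcomp Require Import multiset lra.
Import Order.TTheory GRing.Theory Num.Theory.
Import numFieldNormedType.Exports.

Set Implicit Arguments.
Unset Strict Implicit.
Unset Printing Implicit Defensive.

Local Open Scope classical_set_scope.
Local Open Scope ring_scope.

(** Let [halflife x] be half the lifetime of a point [x]; it vanishes on the
    diagonal.  Everything rests on one inequality
    ([halflife_le_displacement]): for every matching [g], every matched pair
    [(x, y)] satisfies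
      [halflife x + halflife y <= `|x - y|].

    If one of the two points is diagonal, this is because [halflife] is
    1-Lipschitz for the supremum norm.  If both points come from the diagrams,
    it is where orthogonality enters.  Two lifetime intervals that overlap
    give two tents, hence two first landscape functions, that are bounded
    below by a common positive constant on a common nondegenerate interval;
    the first integral in the inner product is then positive, and so is the
    inner product, whose terms are all nonnegative.  So orthogonality makes the
    open lifetime intervals of a point of [D1] and a point of [D2] disjoint
    ([orthogonal_disjoint]).  When one interval lies entirely before the other,
    the births differ by at least one lifetime and the deaths by at least the
    other, and the larger of these differences is at least the average
    [halflife x + halflife y].

    The trivial matching pays for each half-life separately: its displacements
    are exactly the half-lives of the points of [D1] and of [D2], each occurring
    once.  Hence the bottleneck cost of [g] dominates every
    displacement of the trivial matching, and superadditivity of the [p]-th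
    power for [p >= 1] gives
      [halflife x `^ p + halflife y `^ p <= `|x - y| `^ p],
    whose sum over all matched pairs bounds the Wasserstein cost. *)

(** * Tents and the first landscape function *)

Section Landscapes.
Context {R : realType}.
Implicit Types (x : R * R) (D : {mset (R * R)%type}%mset).

Lemma tent_ge0 x t : 0 <= tent x t.
Proof.
rewrite /tent; case: ifP => [/andP[? ?]|_]; first by rewrite subr_ge0.
by case: ifP => [/andP[? ?]|_]; rewrite ?subr_ge0.
Qed.

Lemma tent_ge x e t : 0 <= e -> x.1 + e <= t <= x.2 - e -> e <= tent x t.
Proof.
move=> e0 /andP[xt tx]; rewrite /tent.
case: ifP => [_|/negbT]; first by lra.
rewrite negb_and -!ltNge => /orP[?|mid_t]; first by lra.
by rewrite ifT; [lra | apply/andP; split; lra].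
Qed.

Lemma landscape_ge0 D j t : 0 <= landscape D j t.
Proof.
rewrite /landscape; set s := sort _ _.
have [js|sj] := ltnP j (size s); last by rewrite nth_default.
by have := mem_nth 0 js; rewrite mem_sort => /mapP[x _ ->]; exact: tent_ge0.
Qed.

Lemma tent_le_landscape D (i : 'I_(size D)) t :
  tent (dgm_pt i) t <= landscape D 0 t.
Proof.
rewrite /landscape; set s := sort _ _.
have : tent (dgm_pt i) t \in s.
  by rewrite mem_sort; apply/map_f; exact: mem_tnth.
move=> /(nthP 0)[k ks <-].
have s_sorted : sorted >=%R s.
  by apply: sort_sorted => a b; exact: ge_total.
have s_gt0 : (0 < size s)%N by exact: leq_ltn_trans ks.
exact: (sorted_leq_nth (@ge_trans _ R) (@ge_refl _ R) 0 s_sorted 0 k).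
Qed.

End Landscapes.

(** * Orthogonality separates lifetime intervals *)

(** The integral of a nonnegative function is the supremum of the integrals of
    the simple functions below it, and this family grows with the function.
    Argued this way, monotonicity applies to landscape functions without a
    study of the measurability of sorted values. *)
Lemma ge0_le_integralT d (T : measurableType d) (R : realType)
    (mu : {measure set T -> \bar R}) (f g : T -> \bar R) :
  (forall x, (0 <= f x)%E) -> (forall x, (f x <= g x)%E) ->
  (\int[mu]_x f x <= \int[mu]_x g x)%E.
Proof.
move=> f0 fg.
have g0 x : (0 <= g x)%E by exact: le_trans (fg x).
rewrite !ge0_integralTE//; apply: ereal_sup_le => _ [h hf <-].
by exists h => // x; exact: le_trans (fg x).
Qed.

Lemma integral_gt0_itv (R : realType) (f : R -> R) (a b c : R) :
  a < b -> 0 < c -> (forall t, 0 <= f t) ->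
  (forall t, a <= t <= b -> c <= f t) ->
  (0 < \int[@lebesgue_measure R]_t (f t)%:E)%E.
Proof.
move=> ab c0 f0 cf.
apply: (@lt_le_trans _ _ (\int[lebesgue_measure]_(t in `[a, b]) cst c%:E t)%E).
  rewrite integral_cst; last exact: measurable_itv.
  have := lebesgue_measure_itv `[a, b]%R; rewrite /= lte_fin ab => ->.
  by rewrite -EFinD -EFinM lte_fin mulr_gt0// subr_gt0.
rewrite integral_mkcond; apply: ge0_le_integralT => t.
  by apply: erestrict_ge0 => ? _; rewrite lee_fin ltW.
rewrite /patch; case: ifPn => [|_]; last by rewrite lee_fin.
by rewrite inE /= in_itv /= lee_fin; exact: cf.
Qed.

Section Orthogonality.
Context {R : realType} {theta0 : R}.
Implicit Types D : diagram theta0.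

Lemma dgm_pt_lt D (i : 'I_(size D)) : (dgm_pt i).1 < (dgm_pt i).2.
Proof.
suff /dgm_valid/andP[] : dgm_pt i \in (D : {mset (R * R)%type}%mset) by [].
by rewrite -topredE /=; exact: mem_tnth.
Qed.

Lemma orthogonal_integral0 D1 D2 : orthogonal_diagrams D1 D2 ->
  (\int[@lebesgue_measure R]_t
     (landscape D1 0 t * landscape D2 0 t)%:E)%E = 0%E.
Proof.
pose u j := (\int[@lebesgue_measure R]_t
  (landscape D1 j t * landscape D2 j t)%:E)%E.
have u_ge0 j : (0 <= u j)%E.
  by apply: integral_ge0 => t _; rewrite lee_fin mulr_ge0// landscape_ge0.
rewrite /orthogonal_diagrams /landscape_inner -/(u _) => uoo.
apply/eqP; rewrite eq_le u_ge0 andbT -uoo.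
have := @nneseries_lim_ge R u xpredT 0 1 (fun n _ _ => u_ge0 n).
by rewrite big_nat1.
Qed.

Lemma orthogonal_disjoint D1 D2 (i : 'I_(size D1)) (j : 'I_(size D2)) :
  orthogonal_diagrams D1 D2 ->
  (dgm_pt i).2 <= (dgm_pt j).1 \/ (dgm_pt j).2 <= (dgm_pt i).1.
Proof.
move=> /orthogonal_integral0 orth.
have := dgm_pt_lt i; have := dgm_pt_lt j.
set x := dgm_pt i; set y := dgm_pt j => ylt xlt.
have [|xy] := leP x.2 y.1; first by left.
have [|yx] := leP y.2 x.1; first by right.
exfalso.
pose b := Num.max x.1 y.1; pose d := Num.min x.2 y.2.
have bd : b < d by rewrite /b /d gt_max !lt_min xlt ylt xy yx.
(* On the middle third of the overlap both tents are at least a third of its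
   length. *)
pose e := (d - b) / 3%:R.
have e0 : 0 < e by rewrite divr_gt0// subr_gt0.
have [bx by_] : x.1 <= b /\ y.1 <= b by rewrite /b !le_max !lexx orbT.
have [dx dy] : d <= x.2 /\ d <= y.2 by rewrite /d !ge_min !lexx orbT.
have be : b + e < d - e by rewrite /e; lra.
suff : (0 < \int[@lebesgue_measure R]_t
    (landscape D1 0 t * landscape D2 0 t)%:E)%E by rewrite orth ltxx.
apply: (integral_gt0_itv be (mulr_gt0 e0 e0)) => t.
  by rewrite mulr_ge0// landscape_ge0.
move=> /andP[bt td].
apply: ler_pM; rewrite ?(ltW e0)//.
- apply: le_trans (tent_le_landscape i t); apply: tent_ge; first exact: ltW.
  by rewrite -/x; apply/andP; split; lra.
- apply: le_trans (tent_le_landscape j t); apply: tent_ge; first exact: ltW.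
  by rewrite -/y; apply/andP; split; lra.
Qed.

End Orthogonality.

(** * Half-lives and displacements *)

Section Halflife.
Context {R : realType} {theta0 : R}.
Implicit Types x y : R * R.

Definition halflife x : R := (x.2 - x.1) / 2.

Lemma halflife_diagonal x : Defs.diagonal theta0 x -> halflife x = 0.
Proof. by case=> t _ ->; rewrite /halflife subrr mul0r. Qed.

Lemma le_sup_norm x y :
  `|x.1 - y.1| <= `|x - y| /\ `|x.2 - y.2| <= `|x - y|.
Proof. by rewrite prod_normE !le_max !lexx orbT. Qed.

Lemma halflife_lipschitz x y : halflife x - halflife y <= `|x - y|.
Proof.
have [] := le_sup_norm x y; rewrite /halflife !ler_norml.
by move=> /andP[? ?] /andP[? ?]; lra.
Qed.

Lemma halflife_le_diagonal x y :
  Defs.diagonal theta0 y -> halflife x <= `|x - y|.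
Proof.
move=> y_diag; have := halflife_lipschitz x y.
by rewrite (halflife_diagonal y_diag) subr0.
Qed.

Lemma norm_sub_midpoint x : x.1 <= x.2 -> `|x - midpoint x| = halflife x.
Proof.
move=> x12; rewrite prod_normE /= /halflife.
rewrite ler0_norm ?ger0_norm; [|lra|lra].
by rewrite max_l; lra.
Qed.

Lemma halflife_disjoint x y : x.1 <= x.2 -> y.1 <= y.2 ->
  x.2 <= y.1 \/ y.2 <= x.1 -> halflife x + halflife y <= `|x - y|.
Proof.
move=> x12 y12; have [] := le_sup_norm x y; rewrite /halflife !ler_norml.
by move=> /andP[? ?] /andP[? ?] []; lra.
Qed.

End Halflife.

Section Displacement.
Context {R : realType} {theta0 : R}.
Variables D1 D2 : diagram theta0.

Lemma halflife_le_displacement (g : matching D1 D2) i :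
  orthogonal_diagrams D1 D2 ->
  halflife (ext_pt (@add1 _ _ _ _ g) i) +
  halflife (ext_pt (@add2 _ _ _ _ g) (gamma i)) <= displacement i.
Proof.
move=> orth; rewrite /displacement; case: i => i; case: (gamma _) => j /=.
- have := orthogonal_disjoint i j orth.
  by apply: halflife_disjoint; exact/ltW/dgm_pt_lt.
- have j_diag := add2_diagonal j.
  rewrite (halflife_diagonal j_diag) addr0.
  exact: halflife_le_diagonal j_diag.
- have i_diag := add1_diagonal i.
  rewrite (halflife_diagonal i_diag) add0r distrC.
  exact: halflife_le_diagonal i_diag.
- have i_diag := add1_diagonal i; have j_diag := add2_diagonal j.
  by rewrite (halflife_diagonal i_diag) (halflife_diagonal j_diag) addr0.
Qed.

Lemma halflife_ext_ge0 (D : diagram theta0) n (add : 'I_n -> R * R) k :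
  (forall i, Defs.diagonal theta0 (add i)) ->
  0 <= halflife (ext_pt (D := D) add k).
Proof.
move=> add_diag; case: k => i /=; last first.
  by rewrite (halflife_diagonal (add_diag i)).
by rewrite divr_ge0// subr_ge0 ltW// dgm_pt_lt.
Qed.

Lemma trivial_displacement (k : 'I_(size D1) + 'I_(size D2)) :
  displacement (g := trivial_matching D1 D2) k =
  match k with inl i => halflife (dgm_pt i) | inr j => halflife (dgm_pt j) end.
Proof.
rewrite /displacement; case: k => i /=.
  by apply: norm_sub_midpoint; exact/ltW/dgm_pt_lt.
by rewrite distrC; apply: norm_sub_midpoint; exact/ltW/dgm_pt_lt.
Qed.

End Displacement.

(** * Costs *)

Lemma powR_superadditive (R : realType) (a b p : R) :
  0 <= a -> 0 <= b -> 1 <= p -> a `^ p + b `^ p <= (a + b) `^ p.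
Proof.
move=> a0 b0 p1; have p0 : 0 < p by exact: lt_le_trans p1.
have ab0 : 0 <= a + b by exact: addr_ge0.
(* Write each power as [c * c `^ (p - 1)] and enlarge the second factor. *)
rewrite -(mulr_powRB1 a0 p0) -(mulr_powRB1 b0 p0) -(mulr_powRB1 ab0 p0) mulrDl.
by apply: lerD; apply: ler_wpM2l => //; apply: ge0_ler_powR;
  rewrite ?nnegrE ?subr_ge0 ?lerDl ?lerDr.
Qed.

Lemma inf_range_min (R : realType) (T : Type) (f : T -> R) (a : T) :
  (forall b, f a <= f b) -> f a = inf (range f).
Proof.
move=> amin.
have lb : lbound (range f) (f a) by move=> _ [b _ <-]; exact: amin.
apply/eqP; rewrite eq_le; apply/andP; split.
  by apply: lb_le_inf => //; exists (f a); exists a.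
by apply: ge_inf; [exists (f a) | exists a].
Qed.

Section Costs.
Context {R : realType} {theta0 : R}.
Variables (D1 D2 : diagram theta0) (g : matching D1 D2).
Hypothesis orth : orthogonal_diagrams D1 D2.

Let h1 k := halflife (ext_pt (D := D1) (@add1 _ _ _ _ g) k).
Let h2 k := halflife (ext_pt (D := D2) (@add2 _ _ _ _ g) k).

Let h1_ge0 k : 0 <= h1 k.
Proof. by apply: halflife_ext_ge0; exact: add1_diagonal. Qed.

Let h2_ge0 k : 0 <= h2 k.
Proof. by apply: halflife_ext_ge0; exact: add2_diagonal. Qed.

Lemma bottleneck_cost_trivial :
  bottleneck_cost (trivial_matching D1 D2) <= bottleneck_cost g.
Proof.
have le_cost k : displacement (g := g) k <= bottleneck_cost g.
  exact: (le_bigmax 0 (@displacement _ _ _ _ g) k).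
have cost_ge0 : 0 <= bottleneck_cost g.
  by rewrite /bottleneck_cost; exact: bigmax_ge_id.
apply: bigmax_le => // -[] i _; rewrite trivial_displacement.
  apply: le_trans (le_cost (inl i)).
  by apply: le_trans (halflife_le_displacement _ orth); rewrite lerDl h2_ge0.
have [gi _ giK] := gamma_bij g.
apply: le_trans (le_cost (gi (inl i))).
apply: le_trans (halflife_le_displacement _ orth).
by rewrite giK lerDr h1_ge0.
Qed.

Lemma wasserstein_cost_trivial p : 1 <= p ->
  wasserstein_cost p (trivial_matching D1 D2) <= wasserstein_cost p g.
Proof.
move=> p1; have p0 : 0 < p by exact: lt_le_trans p1.
have sum_ge0 (h : matching D1 D2) :
    \sum_k (displacement (g := h) k) `^ p \is Num.nneg.
  by rewrite nnegrE; apply: sumr_ge0 => k _; exact: powR_ge0.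
apply: ge0_ler_powR; rewrite ?invr_ge0 ?(ltW p0)//.
(* Added diagonal points contribute [0 `^ p = 0], as [p != 0]. *)
have h1_sum :
    \sum_(i < size D1) (halflife (dgm_pt i)) `^ p = \sum_k (h1 k) `^ p.
  rewrite big_sumType /= [X in _ = _ + X]big1 ?addr0// => i _.
  by rewrite /h1 /= (halflife_diagonal (add1_diagonal i)) powR0// gt_eqF.
have h2_sum :
    \sum_(i < size D2) (halflife (dgm_pt i)) `^ p = \sum_k (h2 k) `^ p.
  rewrite big_sumType /= [X in _ = _ + X]big1 ?addr0// => i _.
  by rewrite /h2 /= (halflife_diagonal (add2_diagonal i)) powR0// gt_eqF.
under eq_bigr do rewrite trivial_displacement.
rewrite big_sumType /= h1_sum h2_sum.
rewrite [X in _ + X](reindex _ (onW_bij _ (gamma_bij g))) -big_split /=.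
apply: ler_sum => k _.
apply: (le_trans (powR_superadditive (h1_ge0 k) (h2_ge0 _) p1)).
by apply: ge0_ler_powR (halflife_le_displacement k orth);
  rewrite ?nnegrE ?addr_ge0 ?h1_ge0 ?h2_ge0 ?normr_ge0 ?(ltW p0).
Qed.

End Costs.

Theorem proposition5 (R : realType) (theta0 : R) (D1 D2 : diagram theta0) :
  orthogonal_diagrams D1 D2 ->
  bottleneck_perfect (trivial_matching D1 D2) /\
  (forall p : R, 1 <= p -> wasserstein_perfect p (trivial_matching D1 D2)).
Proof.
move=> orth; split=> [|p p1]; apply: inf_range_min => g.
  exact: bottleneck_cost_trivial.
exact: wasserstein_cost_trivial.
Qed.
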